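(* Let $(D,E,\mathbf{w})$ be a weighted oriented complete graph on $n\ge 2$ vertices, with vertex set $\{1,\dots,n\}$, and let $I(D,\mathbf{w})\subseteq S=\mathrm{k}[x_1,\dots,x_n]$ be its edge ideal. Then $$\operatorname{reg}\left(\overline{I(D,\mathbf{w})}\right)=\max\{\mathbf{w}(j)\mid j=1,\dots,n\}+1.$$
   Context: $\mathrm{k}$ is an arbitrary field and $S=\mathrm{k}[x_1,\dots,x_n]$ is the standard graded polynomial ring. A weighted oriented complete graph $(D,E,\mathbf{w})$ on $n$ vertices consists of an oriented complete graph $D$ with vertex set $V(D)=\{1,\dots,n\}$ (for each pair $i\neq j$ exactly one of $(i,j)$, $(j,i)$ belongs to the set $E=E(D)$ of directed edges, and there are no loops), together with a weight function $\mathbf{w}:V(D)\to\mathbb{Z}_+$ (positive integers) such that $\mathbf{w}(j)=1$ whenever $j$ is a source vertex, i.e. whenever there is no $i$ with $(i,j)\in E(D)$. Its edge ideal is $$I(D,\mathbf{w})=\left(x_i x_j^{\mathbf{w}(j)} \mid (i,j)\in E(D)\right)\subseteq S.$$ For an ideal $I$ of $S$, $\overline{I}$ denotes its integral closure. The symbol $\operatorname{reg}$ denotes Castelnuovo-Mumford regularity: with $\mathfrak{m}=(x_1,\dots,x_n)$, for a finitely generated graded $S$-module $L$, $\operatorname{reg}(L)=\max\{i+j\mid H^i_{\mathfrak{m}}(L)_j\ne 0\}$, where $H^i_{\mathfrak m}$ is local cohomology. *)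

(* Defs.v *)
From mathcomp Require Import all_boot all_order all_algebra.
From mathcomp Require Import mpoly.

Set Implicit Arguments.
Unset Strict Implicit.
Unset Printing Implicit Defensive.

Import GRing.Theory.
Local Open Scope ring_scope.

Section Ideals.
Variable R : comNzRingType.

Definition ideal_gen (G : R -> Prop) (f : R) : Prop :=
  exists s : seq (R * R),
    (forall p, p \in s -> G p.2) /\ f = \sum_(p <- s) p.1 * p.2.

(* [ideal_pow I 0] is the unit ideal (generated by the empty product). *)
Definition ideal_pow (I : R -> Prop) (m : nat) : R -> Prop :=
  ideal_gen (fun g => exists t : m.-tuple R,
    (forall k, I (tnth t k)) /\ g = \prod_(k < m) tnth t k).

Definition integral_closure (I : R -> Prop) (f : R) : Prop :=
  exists (m : nat) (a : nat -> R),
    [/\ (0 < m)%N,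
        forall i, (1 <= i <= m)%N -> ideal_pow I i (a i)
      & f ^+ m + \sum_(1 <= i < m.+1) a i * f ^+ (m - i) = 0].

End Ideals.

(* Local cohomology at (x_1, ..., x_n) of a graded ideal J of k[x_1, ..., x_n],
   as the cohomology of the Cech complex of J on x_1, ..., x_n.  Its component
   at a set F of variables is the localization of J at x_F, which we view
   inside the field of fractions. *)
Section LocalCohomology.
Variables (k : fieldType) (n : nat).
Implicit Types (J : {mpoly k[n]} -> Prop) (F : {set 'I_n}) (j : int).

(* The graded piece of degree j of k[x_1, ..., x_n]; it is 0 when j < 0, which
   is why [dhomog], indexed by natural numbers, is not used here. *)
Definition homog_of_deg j (f : {mpoly k[n]}) : Prop :=
  forall m, m \in msupp f -> (mdeg m)%:Z = j.

Definition varprod F : {mpoly k[n]} := \prod_(v in F) 'X_v.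

Definition loc_deg J F j (z : {fraction {mpoly k[n]}}) : Prop :=
  exists (N : nat) (f : {mpoly k[n]}),
    [/\ J f, homog_of_deg (j + (N * #|F|)%:Z) f
      & z = tofrac f / tofrac (varprod F) ^+ N].

Definition cochain := {ffun {set 'I_n} -> {fraction {mpoly k[n]}}}.

Definition cech J (i : nat) j (c : cochain) : Prop :=
  forall F, if #|F| == i then loc_deg J F j (c F) else c F = 0.

Definition cech_d (c : cochain) : cochain :=
  [ffun F : {set 'I_n} =>
    \sum_(v in F) (-1) ^+ #|[set u in F | (u < v)%N]| * c (F :\ v)].

Definition is_coboundary J (i : nat) j (c : cochain) : Prop :=
  if i is i'.+1 then exists2 b, cech J i' j b & c = cech_d b else c = 0.

Definition local_cohomology_neq0 J (i : nat) j : Prop :=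
  exists c, [/\ cech J i j c, cech_d c = 0 & ~ is_coboundary J i j c].

(* reg J = r: the maximum defining the regularity exists and equals r. *)
Definition has_reg J (r : int) : Prop :=
  (exists (i : nat) j, local_cohomology_neq0 J i j /\ i%:Z + j = r) /\
  (forall (i : nat) j, local_cohomology_neq0 J i j -> i%:Z + j <= r).

End LocalCohomology.

Record wo_complete_graph (n : nat) := WOCompleteGraph {
  edge : rel 'I_n;
  weight : 'I_n -> nat;
  edge_irrefl : forall i, ~~ edge i i;
  edge_oriented : forall i j, i != j -> edge i j (+) edge j i;
  weight_gt0 : forall j, (0 < weight j)%N;
  weight_source : forall j, (forall i, ~~ edge i j) -> weight j = 1%N
}.

Definition edge_ideal (k : fieldType) (n : nat) (D : wo_complete_graph n) :
    {mpoly k[n]} -> Prop :=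
  ideal_gen (fun f => exists i j : 'I_n,
    edge D i j /\ f = 'X_i * 'X_j ^+ weight D j).

Arguments edge_ideal k {n} D _.

(* Main.v *)
Require Import Defs.
From mathcomp Require Import all_boot all_order all_algebra.
From mathcomp Require Import mpoly.
From mathcomp Require Import perm ring lra zify.
From Stdlib Require Import Classical_Prop.

(** Let [W] be the largest weight and [J] the integral closure of the edge
    ideal. The proof computes [J] by linear programming duality and then its
    local cohomology one multidegree at a time.

    The integral closure of a monomial ideal consists of the polynomials all of
    whose monomials have value at least one under each monomial valuation that
    is at least one on the generators ([integral_newton], [newton_integral]).
    One inclusion compares the parts of least value in an equation of integral
    dependence. The other uses Farkas' lemma, to write an exponent on which the
    valuations are at least [N + 1] as a generator plus an exponent on which
    they are at least [N], and then the determinant trick.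

    For the edge ideal, the relevant valuations are vectors [y >= 0] with
    [y i + w j * y j >= 1] for every arc from [i] to [j]. Inverting [x_v] leaves
    an ideal generated by a power of each other variable, so membership in the
    localization of [J] at [v] is decided by the single valuation [link_val v];
    the localization at two or more variables is the whole ring, because any
    two vertices are joined. Two estimates on an exponent [c >= 0] follow. If
    the values of [c] at [link_val v] and [link_val v'] are both less than one
    for distinct [v] and [v'], then [|c| < W] ([two_links_lt1_deg]). If [c] is
    in all the localizations at one variable and [|c| > W], then [c] is an
    exponent of [J] ([links_inJ]).

    The part of the Cech complex of [J] in multidegree [a] is spanned by the
    sets [F] of variables such that [x^a] lies in the localization of [J] at
    [F], a family closed under supersets. Contraction of the full simplex onto
    a vertex [v] bounds the cocycles of cohomological degree [i] as soon as
    removing [v] from a set of [i] elements does not leave the family. By the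
    estimates, such a [v] exists whenever [i + |a| > W + 1] ([cone_vertex]), so
    all cohomology of positive degree vanishes there ([cech_acyclic]); in degree
    zero there are no cocycles. Here [|a|] is the sum of the coordinates of [a].

    The bound is attained in cohomological degree two and multidegree
    [(W - 1) e_q], with [q] of weight [W]: there the localizations at [q] and at a
    second vertex [p], an in-neighbour of [q] if [W > 1], do not contain the
    monomial, whereas those at all pairs do. The coboundary of the simplex at [p] is then a cocycle that is
    not a coboundary in the complex ([local_cohomology2_neq0]). *)

Set Implicit Arguments.
Unset Strict Implicit.
Unset Printing Implicit Defensive.

Import Order.TTheory GRing.Theory Num.Theory.
Local Open Scope ring_scope.

(** * Farkas' lemma *)

(** The proof is Bartl's induction on the number of rows. If the first row [c]
    is positive on a point [x1] that separates [b] from the other rows, then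
    projecting along [x1] onto the kernel of [c] leaves a system with one row
    less. *)
Lemma farkas (F : realFieldType) (m d : nat) (A : 'M[F]_(m, d)) (b : 'rV[F]_d) :
  (exists u : 'rV[F]_m, (forall i, 0 <= u 0 i) /\ u *m A = b) \/
  (exists x : 'cV[F]_d, (forall i, (A *m x) i 0 <= 0) /\ 0 < (b *m x) 0 0).
Proof.
elim: m A b => [|m IHm] A b.
  have [->|b0] := eqVneq b 0.
    by left; exists 0; split=> [[]//|]; rewrite mul0mx.
  right; exists b^T; split=> [[]//|].
  rewrite mxE lt0r sumr_ge0 ?andbT => [|i _]; last by rewrite mxE -expr2 sqr_ge0.
  rewrite psumr_eq0 => [|i _]; last by rewrite mxE -expr2 sqr_ge0.
  apply: contra b0 => /allP b0; apply/eqP/rowP => i; rewrite mxE.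
  have := b0 i (mem_index_enum _).
  by rewrite mxE mulf_eq0 orbb => /eqP.
rewrite -[m.+1]/(1 + m)%N in A *.
rewrite -[A]vsubmxK; move: (usubmx A) (dsubmx A) => c A1 {A}.
have AE x i : (col_mx c A1 *m x) i 0 =
    match split i with inl _ => (c *m x) 0 0 | inr j => (A1 *m x) j 0 end.
  by rewrite mul_col_mx mxE; case: split => // j; rewrite (ord1 j).
have [[u [u0 uA]]|[x0 [x0A x0b]]] := IHm A1 b.
  left; exists (row_mx (0 : 'rV_1) u); split.
    by move=> i; rewrite mxE; case: (split i) => // j; rewrite mxE.
  by rewrite mul_row_col mul0mx add0r.
have [cx0|cx0] := lerP ((c *m x0) 0 0) 0.
  by right; exists x0; split=> // i; rewrite AE; case: split.
have [x1 [x1A x1b cx1]] : exists x1, [/\ forall i, (A1 *m x1) i 0 <= 0,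
    0 < (b *m x1) 0 0 & c *m x1 = 1%:M].
  pose s := (c *m x0) 0 0; exists (s^-1 *: x0).
  have s0 : 0 < s^-1 by rewrite invr_gt0.
  split=> [i||]; rewrite -scalemxAr.
  - by rewrite mxE pmulr_rle0.
  - by rewrite mxE pmulr_rgt0.
  - apply/matrixP=> i j; by rewrite !ord1 mxE [RHS]mxE eqxx mulVf ?gt_eqF.
(* Subtracting multiples of [c] composes all functionals with that projection. *)
have [[u [u0 uA]]|[x [xA xb]]] :=
  IHm (A1 - (A1 *m x1) *m c) (b - (b *m x1) *m c).
  left; exists (row_mx (b *m x1 - u *m (A1 *m x1)) u); split.
    move=> i; rewrite mxE; case: (split i) => // j; rewrite ord1.
    rewrite [X in _ <= X]mxE [X in _ + X]mxE subr_ge0 [X in X <= _]mxE.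
    apply: le_trans (ltW x1b); apply: sumr_le0 => k _.
    by rewrite mulr_ge0_le0.
  rewrite mul_row_col -[RHS](subrK (b *m x1 *m c)) -uA.
  by rewrite mulmxBr mulmxBl !mulmxA [RHS]addrC addrA addrAC.
right; exists (x - x1 *m (c *m x)); split=> [i|].
  rewrite AE; case: split => j; last by rewrite mulmxBr !mulmxA -mulmxBl.
  by rewrite mulmxBr (mulmxA c) cx1 mul1mx subrr mxE.
by rewrite mulmxBr !mulmxA -mulmxBl.
Qed.

(** * Integral dependence and the determinant trick *)

Section IdealPowers.
Variable R : comNzRingType.
Implicit Types (G I : R -> Prop) (f g : R).

Lemma ideal_gen_mem G g : G g -> ideal_gen G g.
Proof.
move=> Gg; exists [:: (1, g)]; split; last by rewrite big_seq1 mul1r.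
by move=> p; rewrite inE => /eqP ->.
Qed.

Lemma ideal_gen0 G : ideal_gen G 0.
Proof. by exists [::]; split=> //; rewrite big_nil. Qed.

Lemma ideal_genD G f g : ideal_gen G f -> ideal_gen G g -> ideal_gen G (f + g).
Proof.
move=> [s [sG ->]] [t [tG ->]]; exists (s ++ t); rewrite big_cat; split=> // p.
by rewrite mem_cat => /orP[/sG|/tG].
Qed.

Lemma ideal_genM G f g : ideal_gen G g -> ideal_gen G (f * g).
Proof.
move=> [s [sG ->]]; exists [seq (f * p.1, p.2) | p <- s]; split.
  by move=> p /mapP[q /sG Gq ->].
by rewrite big_map mulr_sumr; apply: eq_bigr => p _; rewrite mulrA.
Qed.

Lemma ideal_genN G f : ideal_gen G f -> ideal_gen G (- f).
Proof. by rewrite -mulN1r; exact: ideal_genM. Qed.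

Lemma ideal_gen_sum G (T : Type) (s : seq T) (P : pred T) (F : T -> R) :
  (forall t, P t -> ideal_gen G (F t)) -> ideal_gen G (\sum_(t <- s | P t) F t).
Proof. by move=> GF; elim/big_ind: _ => //; [exact: ideal_gen0|exact: ideal_genD]. Qed.

Lemma ideal_gen_sub G G' f :
  (forall g, G g -> ideal_gen G' g) -> ideal_gen G f -> ideal_gen G' f.
Proof.
move=> GG' [s [sG ->]]; rewrite big_seq.
by apply: ideal_gen_sum => p ps; apply/ideal_genM/GG'/sG.
Qed.

Lemma ideal_pow0 I f : ideal_pow I 0 f.
Proof.
rewrite -[f]mulr1; apply/ideal_genM/ideal_gen_mem.
by exists [tuple]; rewrite big_ord0; split=> // -[].
Qed.

Lemma ideal_pow1 I f : I f -> ideal_pow I 1 f.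
Proof.
move=> If; apply: ideal_gen_mem; exists [tuple f]; rewrite big_ord1; split=> //.
by move=> k; rewrite (ord1 k).
Qed.

Lemma ideal_powM I i j f g :
  ideal_pow I i f -> ideal_pow I j g -> ideal_pow I (i + j) (f * g).
Proof.
move=> [s [sI ->]] [t [tI ->]]; rewrite big_distrlr /= big_seq.
apply: ideal_gen_sum => p ps; rewrite big_seq; apply: ideal_gen_sum => q qt.
rewrite mulrACA; apply/ideal_genM/ideal_gen_mem.
have [[a [aI ->]] [b [bI ->]]] := (sI p ps, tI q qt).
exists (cat_tuple a b); rewrite big_split_ord /=; split.
  by move=> k; rewrite -(splitK k); case: split => x /=; rewrite ?tnth_lshift ?tnth_rshift.
by congr (_ * _); apply: eq_bigr => k _; rewrite ?tnth_lshift ?tnth_rshift.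
Qed.

Lemma ideal_pow_le I i j f : (j <= i)%N -> ideal_pow I i f -> ideal_pow I j f.
Proof.
move=> ji; apply: ideal_gen_sub => g [t [tI ->]].
have -> : \prod_(k < i) tnth t k = \prod_(0 <= k < i) nth 0 t k.
  by rewrite big_mkord; apply: eq_bigr => k _; rewrite (tnth_nth 0).
rewrite (big_cat_nat (n := j)) //= mulrC; apply/ideal_genM/ideal_gen_mem.
exists [tuple nth 0 t k | k < j]; split; last first.
  by rewrite big_mkord; apply: eq_bigr => k _; rewrite tnth_mktuple.
move=> k; rewrite tnth_mktuple.
have ki : (k < i)%N by exact: leq_trans ji.
by rewrite -[k : nat]/(Ordinal ki : nat) -tnth_nth.
Qed.

(** The form of degree [d] when the indeterminate and the elements of [I] both
    have degree one; these forms make up a Rees algebra of [I], in which a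
    characteristic polynomial with entries in [I] is homogeneous. *)
Definition rees I (d : nat) (p : {poly R}) : Prop :=
  forall i, ideal_pow I (d - i) p`_i.

Lemma reesM I d e p q : rees I d p -> rees I e q -> rees I (d + e) (p * q).
Proof.
move=> pd qe i; rewrite coefM; apply: ideal_gen_sum => j _.
apply: (@ideal_pow_le _ ((d - j) + (e - (i - j)))); last exact: ideal_powM.
by have := ltn_ord j; lia.
Qed.

Lemma rees_prod I m (p : 'I_m -> {poly R}) :
  (forall k, rees I 1 (p k)) -> rees I m (\prod_k p k).
Proof.
elim: m p => [|m IHm] p pI; first by move=> i; rewrite sub0n; exact: ideal_pow0.
move=> i; rewrite big_ord_recr /=.
have := reesM (IHm (fun k => p (widen_ord (leqnSn m) k)) (fun k => pI _))
  (pI ord_max) i.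
by rewrite addn1.
Qed.

Lemma rees_char_poly I m (B : 'M[R]_m) :
  (forall i j, I (B i j)) -> rees I m (char_poly B).
Proof.
move=> BI i; rewrite /char_poly /determinant coef_sum.
apply: ideal_gen_sum => s _.
have -> : (-1) ^+ odd_perm s = ((-1) ^+ odd_perm s)%:P :> {poly R}.
  by rewrite rmorphXn rmorphN1.
rewrite coefCM; apply/ideal_genM/rees_prod => k [|l]; last exact: ideal_pow0.
rewrite !mxE coefB coefC coefMn coefX mul0rn sub0r.
by apply/ideal_genN/ideal_pow1.
Qed.

End IdealPowers.

(** The determinant trick: [f] is an eigenvalue of the matrix [B] with entries
    in [I], so it is a root of the characteristic polynomial of [B]; the
    coefficient of degree [m - i] of the latter is a sum of products of [i]
    entries of [B]. *)
Lemma determinant_trick (R : idomainType) (I : R -> Prop) (f : R) m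
    (B : 'M[R]_m) (u : 'cV[R]_m) :
  (forall i j, I (B i j)) -> u != 0 -> B *m u = f *: u -> integral_closure I f.
Proof.
move=> BI u0 Bu; exists m, (fun i => (char_poly B)`_(m - i)).
have m0 : (0 < m)%N.
  by case: (m) B u u0 {BI Bu} => // B u; rewrite [u]flatmx0 eqxx.
split=> // [i /andP[_ im]|].
  by have := rees_char_poly BI (m - i)%N; rewrite subKn.
have : (char_poly B).[f] = 0.
  rewrite -[LHS]/(horner_eval f _) /char_poly -det_map_mx.
  set C := map_mx _ _; have CE : C = f%:M - B.
    apply/matrixP => i j; rewrite !mxE /= /horner_eval.
    by rewrite hornerD hornerN hornerC hornerMn hornerX.

  apply/eqP; apply: contraR u0 => detC; apply/eqP.
  have : \adj C *m (C *m u) = 0 by rewrite CE mulmxBl Bu mul_scalar_mx subrr mulmx0.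
  rewrite mulmxA mul_adj_mx mul_scalar_mx => /matrixP Cu; apply/matrixP => i j.
  by have /eqP := Cu i j; rewrite !mxE mulf_eq0 (negPf detC) => /eqP.
rewrite horner_coef size_char_poly big_ord_recr /=.
have := char_poly_monic B; rewrite monicE lead_coefE size_char_poly => /eqP -> /=.
rewrite mul1r addrC => pf0; rewrite -[RHS]pf0; congr (_ + _).
rewrite big_add1 big_mkord /= [RHS](reindex_inj rev_ord_inj).
exact: eq_bigr.
Qed.

(** * The integral closure of a monomial ideal *)

Section MonomialSupport.
Variables (k : fieldType) (n : nat).
Implicit Types (P Q : 'X_{1..n} -> Prop) (f g : {mpoly k[n]}).

Definition supported P f := forall m, m \in msupp f -> P m.

Lemma supported0 P : supported P 0.
Proof. by move=> m; rewrite msupp0. Qed.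

Lemma supportedD P f g : supported P f -> supported P g -> supported P (f + g).
Proof. by move=> Pf Pg m /msuppD_le; rewrite mem_cat => /orP[/Pf|/Pg]. Qed.

Lemma supportedN P f : supported P f -> supported P (- f).
Proof. by move=> Pf m; rewrite (perm_mem (msuppN f)) => /Pf. Qed.

Lemma supported_sum P (T : Type) (s : seq T) (A : pred T) (F : T -> {mpoly k[n]}) :
  (forall t, A t -> supported P (F t)) -> supported P (\sum_(t <- s | A t) F t).
Proof. by move=> PF; elim/big_ind: _ => //; [exact: supported0|exact: supportedD]. Qed.

Lemma supportedZX P c m : P m -> supported P (c *: 'X_[m]).
Proof. by move=> Pm m' /msuppZ_le; rewrite msuppX inE => /eqP ->. Qed.

Lemma supportedM P Q S f g : (forall a b, P a -> Q b -> S (a + b)%MM) ->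
  supported P f -> supported Q g -> supported S (f * g).
Proof.
move=> PQS Pf Qg m /msuppM_le /allpairsP[[a b] /= [af bg ->]].
by apply: PQS; [apply: Pf|apply: Qg].
Qed.

End MonomialSupport.

Lemma seq_argmin (T : eqType) (F : realDomainType) (h : T -> F) (s : seq T) x0 :
  x0 \in s -> exists2 x, x \in s & forall y, y \in s -> h x <= h y.
Proof.
elim: s x0 => // a s IHs x0 _.
case: s IHs => [_|b s /(_ b (mem_head _ _)) [x xs xmin]].
  by exists a; rewrite ?mem_head // => y; rewrite inE => /eqP ->.
have [ha|hx] := lerP (h a) (h x).
  exists a; first exact: mem_head.
  by move=> y; rewrite inE => /orP[/eqP -> //|/xmin]; exact: le_trans.
exists x; first by rewrite inE xs orbT.
by move=> y; rewrite inE => /orP[/eqP ->|/xmin //]; exact: ltW.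
Qed.

Lemma seq_choice (T : eqType) (U : Type) (u0 : U) (Q : T -> U -> Prop) (s : seq T) :
  (forall x, x \in s -> exists u, Q x u) ->
  exists f, forall x, x \in s -> Q x (f x).
Proof.
elim: s => [|a s IHs] sQ; first by exists (fun=> u0).
have [|f fP] := IHs; first by move=> x xs; apply: sQ; rewrite inE xs orbT.
have [u uP] := sQ a (mem_head _ _).
exists (fun x => if x == a then u else f x) => x; rewrite inE.
by case: eqP => [-> _ //|_ /= /fP].
Qed.

Section MonomialIdeals.
Variables (k : fieldType) (n : nat) (E : finType) (g : E -> 'X_{1..n}).
Implicit Types (y : 'I_n -> rat) (m a b : 'X_{1..n}) (f : {mpoly k[n]}).

Definition wdot y m : rat := \sum_i y i * (m i)%:R.

Lemma wdotD y a b : wdot y (a + b)%MM = wdot y a + wdot y b.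
Proof. by rewrite -big_split; apply: eq_bigr => i _; rewrite mnmDE natrD mulrDr. Qed.

Lemma wdot0 y : wdot y 0%MM = 0.
Proof. by apply: big1 => i _; rewrite mnm0E mulr0. Qed.

Lemma wdot_ge0 y m : (forall i, 0 <= y i) -> 0 <= wdot y m.
Proof. by move=> y0; apply: sumr_ge0 => i _; rewrite mulr_ge0. Qed.

(** The points [y] of this polyhedron are the monomial valuations that are at
    least one on the ideal. *)
Definition blocking y := (forall i, 0 <= y i) /\ forall e, 1 <= wdot y (g e).

Definition newton (N : nat) m := forall y, blocking y -> N%:R <= wdot y m.

Lemma newtonD N1 N2 a b : newton N1 a -> newton N2 b -> newton (N1 + N2) (a + b)%MM.
Proof. by move=> aN bN y yB; rewrite wdotD natrD lerD ?aN ?bN. Qed.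

Lemma newton_comb N m (c : E -> rat) : (forall e, 0 <= c e) ->
  N%:R <= \sum_e c e -> (forall i, \sum_e c e * (g e i)%:R <= (m i)%:R) ->
  newton N m.
Proof.
move=> c0 cN cm y [y0 yg]; apply: (le_trans cN).
apply: (@le_trans _ _ (\sum_i y i * (\sum_e c e * (g e i)%:R))); last first.
  by apply: ler_sum => i _; apply: ler_wpM2l.
under [leRHS]eq_bigr do rewrite mulr_sumr.
rewrite exchange_big; apply: ler_sum => e _ /=.
under eq_bigr do rewrite mulrCA.
by rewrite -mulr_sumr ler_peMr // yg.
Qed.

(** Linear programming duality. A separating vector given by Farkas' lemma is an
    exponent vector [y] together with a scalar [t] that bounds [y] from below on
    the generators; it contradicts the hypothesis after division by [t]. *)
Lemma newton_combP N m : newton N m ->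
  exists c : E -> rat, [/\ forall e, 0 <= c e, \sum_e c e = N%:R
    & forall i, \sum_e c e * (g e i)%:R <= (m i)%:R].
Proof.
move=> mN; pose G : 'M[rat]_(#|E|, n) := \matrix_(e, i) (g (enum_val e) i)%:R.
pose A := col_mx (row_mx G (const_mx (-1) : 'M_(_, 1))) (row_mx 1%:M 0).
pose v : 'rV[rat]_n := \row_i (m i)%:R.
have [[u [u0 uA]]|[x [xA xb]]] := farkas A (row_mx v (const_mx (- N%:R))).
  move: uA; rewrite -[u]hsubmxK mul_row_col !mul_mx_row mulmx1 mulmx0.
  set c := lsubmx u; set s := rsubmx u; rewrite add_row_mx => /eq_row_mx[cs cN].
  exists (fun e => c 0 (enum_rank e)); split.
  - by move=> e; rewrite mxE.
  - have /matrixP/(_ 0 0) := cN; rewrite addr0 !mxE => /(congr1 -%R).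
    rewrite opprK => <-; rewrite -sumrN (reindex enum_rank) /=; last first.
      by apply: onW_bij; apply: enum_rank_bij.
    by apply: eq_bigr => e _; rewrite [const_mx _ _ _]mxE mulrN1 opprK.
  - move=> i; have /matrixP/(_ 0 i) := cs; rewrite [RHS]mxE => <-.
    rewrite [leRHS]mxE -[leLHS]addr0; apply: lerD; last by rewrite mxE.
    rewrite mxE [leRHS](reindex enum_rank) /=; last first.
      by apply: onW_bij; apply: enum_rank_bij.
    by apply: ler_sum => e _; rewrite [G _ _]mxE enum_rankK.
pose z := usubmx x; pose t := - (dsubmx x) 0 0; pose y i := - z i 0.
have zt : x = col_mx z (dsubmx x) by rewrite vsubmxK.
have y0 i : 0 <= y i.
  have := xA (rshift _ i); rewrite zt mul_col_mx col_mxEd mul_row_col mul1mx.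
  by rewrite mul0mx addr0 oppr_ge0.
have yg e : t <= wdot y (g e).
  have := xA (lshift _ (enum_rank e)); rewrite zt mul_col_mx col_mxEu mul_row_col.
  rewrite mxE [X in _ + X]mxE big_ord1 [const_mx _ _ _]mxE mulN1r -/t.
  rewrite mxE -lerBrDr sub0r -lerN2 opprK -sumrN => /le_trans; apply.
  by apply: ler_sum => i _; rewrite [G _ _]mxE enum_rankK /y mulNr mulrC.
have ym : wdot y m < N%:R * t.
  move: xb; rewrite zt mul_row_col mxE [X in _ + X]mxE big_ord1 [const_mx _ _ _]mxE.
  rewrite mulNr -mulrN -/t mxE.
  rewrite -ltrBlDr sub0r -ltrN2 opprK -sumrN; apply: le_lt_trans.
  by apply: ler_sum => i _; rewrite [v _ _]mxE /y mulNr mulrC.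
have [t0|t0] := ler0P t.
  have := wdot_ge0 m y0; rewrite leNgt (lt_le_trans ym) //.
  by rewrite mulr_ge0_le0.
have wdotZ b : wdot (fun i => t^-1 * y i) b = t^-1 * wdot y b.
  by rewrite mulr_sumr; apply: eq_bigr => i _; rewrite mulrA.
have /mN : blocking (fun i => t^-1 * y i).
  split=> [i|e]; first by rewrite mulr_ge0 // invr_ge0 ltW.
  by rewrite wdotZ ler_pdivlMl // mulr1.
by rewrite wdotZ ler_pdivlMl // mulrC leNgt ym.
Qed.

(** Among at most [N] nonnegative coefficients with sum [N + 1], one is at least
    one; the corresponding generator can be split off. *)
Lemma newton_sub N b : (#|E| <= N)%N -> newton N.+1 b ->
  exists e b', b = (g e + b')%MM /\ newton N b'.
Proof.
move=> EN /newton_combP[c [c0 cN cb]].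
have [e ce] : exists e, 1 <= c e.
  case: (boolP [exists e, 1 <= c e]) => [/existsP//|/existsPn c1].
  suff : N.+1%:R <= #|E|%:R :> rat by rewrite ler_nat leqNgt ltnS EN.
  rewrite -cN cardE -sum1_size natr_sum big_enum /=; apply: ler_sum => e _.
  by rewrite ltW // ltNge.
have geb : (g e <= b)%MM.
  apply/mnm_lepP => i; rewrite -(ler_nat rat); apply: le_trans (cb i).
  rewrite (bigD1 e) //= -[leLHS]addr0; apply: lerD.
    by rewrite ler_peMl.
  by apply: sumr_ge0 => e' _; rewrite mulr_ge0.
exists e, (b - g e)%MM; split; first by rewrite addmC submK.
apply: (@newton_comb _ _ (fun e' => c e' - (e' == e)%:R)) => [e'||i].
- by have [->|_] := eqVneq e' e; rewrite ?subr_ge0 ?subr0.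
- rewrite big_split /= cN sumrN (bigD1 e) //= eqxx big1 => [|e' /negPf -> //].
  by rewrite addr0 -natr1 addrK.
- rewrite mnmBE natrB; last exact: (mnm_lepP geb).
  under eq_bigr do rewrite mulrBl.
  rewrite big_split /= sumrN lerB // (bigD1 e) //= eqxx mul1r big1 ?addr0 //.
  by move=> e' /negPf ->; rewrite mul0r.
Qed.

(** This makes the dilates of the Newton polyhedron finitely generated. *)
Lemma newton_trunc N b C : (forall e i, (N * g e i <= C)%N) -> newton N b ->
  newton N [multinom minn (b i) C | i < n].
Proof.
case: N => [_ _ y [y0 _]|N gC]; first exact: wdot_ge0.
move=> /newton_combP[c [c0 cN cb]]; apply: (newton_comb c0); first by rewrite cN.
move=> i; rewrite mnmE /minn; case: ltnP => _; first exact: cb.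
rewrite -(@ler_pM2l _ N.+1%:R) ?ltr0n // -[in leRHS]cN mulr_sumr mulr_suml.
by apply: ler_sum => e _; rewrite mulrCA ler_wpM2l // -natrM ler_nat.
Qed.

Definition monomial_ideal : {mpoly k[n]} -> Prop :=
  ideal_gen (fun f => exists e, f = 'X_[g e]).

Lemma integral_closure0 : integral_closure monomial_ideal 0.
Proof.
exists 1%N, (fun=> 0); split=> // [i _|]; first exact: ideal_gen0.
by rewrite big_nat1 mul0r addr0 expr1.
Qed.

(** With [N] generators, multiplication by [f] maps the module spanned by the
    monomials of the [N]-th dilate into the ideal times this module, by
    [newton_sub]. By [newton_trunc] the monomials in a box span the module, so
    the determinant trick applies. *)
Lemma newton_integral f : supported (newton 1) f ->
  integral_closure monomial_ideal f.
Proof.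
have [->|f0 fN] := eqVneq f 0; first by move=> _; exact: integral_closure0.
have I0 : monomial_ideal 0 by exact: ideal_gen0.
pose N := #|E|; pose C := (\max_e \max_i N * g e i)%N.
have gC e i : (N * g e i <= C)%N.
  by apply: leq_trans (leq_bigmax e); exact: (leq_bigmax (F := fun i => N * g e i)%N i).
pose mon (t : {ffun 'I_n -> 'I_C.+1}) := [multinom (t i : nat) | i < n].
have /fin_all_exists[p pP] : forall t, exists b : bool, b <-> newton N (mon t).
  move=> t; have [tN|tN] := classic (newton N (mon t)); first by exists true; split.
  by exists false; split=> // /tN.
pose S : finType := {t | p t}; pose u (s : S) : {mpoly k[n]} := 'X_[mon (val s)].
have truncP b : newton N b -> exists s : S, exists r, b = (r + mon (val s))%MM.
  move=> bN; pose t := [ffun i => inord (minn (b i) C) : 'I_C.+1].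
  have tE : mon t = [multinom minn (b i) C | i < n].
    by apply/mnmP => i; rewrite !mnmE ffunE inordK // ltnS geq_minr.
  have pt : p t by apply/pP; rewrite tE; exact: newton_trunc.
  exists (Sub t pt), (b - mon t)%MM; rewrite SubK submK //.
  by apply/mnm_lepP => i; rewrite tE mnmE geq_minl.
pose span h := exists B : S -> {mpoly k[n]},
  (forall s, monomial_ideal (B s)) /\ h = \sum_s B s * u s.
have span_sum (r : seq 'X_{1..n}) (F : 'X_{1..n} -> {mpoly k[n]}) :
    {in r, forall m, span (F m)} -> span (\sum_(m <- r) F m).
  move=> rF; rewrite big_seq; elim/big_ind: _ => // [|h h' [B [BI ->]] [B' [BI' ->]]].
    by exists (fun=> 0); split=> //; rewrite big1 // => s _; rewrite mul0r.
  exists (fun s => B s + B' s); split=> [s|].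
    by apply: ideal_genD; [exact: BI|exact: BI'].
  by rewrite -big_split; apply: eq_bigr => s _; rewrite mulrDl.
have fu s : span (f * u s).
  rewrite [f]mpolyE mulr_suml; apply: span_sum => a /fN a1.
  have /newton_sub-/(_ (leqnn _)) [e [b' [abE /truncP[s' [r rE]]]]] :
      newton N.+1 (a + mon (val s))%MM.
    by rewrite -add1n; apply: newtonD => //; apply/pP/(valP s).
  exists (fun s1 => if s1 == s' then f@_a *: 'X_[r] * 'X_[g e] else 0); split.
    move=> s1; case: eqP => // _.
    by apply/ideal_genM/ideal_gen_mem; exists e.
  rewrite (bigD1 s') //= eqxx big1 => [|s1 /negPf ->]; last by rewrite mul0r.
  rewrite addr0 -!scalerAl -!mpolyXD abE rE; congr (_ *: 'X_[_]).
  by apply/mnmP => i; rewrite !mnmDE; lia.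
have /fin_all_exists[B BP] := fu.
(* The spanning set is not empty: it contains a divisor of the [N]-th power of
   any monomial of [f]. *)
have [a af] : exists a, a \in msupp f.
  by case: (msupp f) (msupp_eq0 f) f0 => [<-//|a r _ _]; exists a; exact: mem_head.
have [s0 _] : exists s0 : S, exists r, (a *+ N)%MM = (r + mon (val s0))%MM.
  apply: truncP => y yB; have := fN a af y yB.
  have -> : wdot y (a *+ N)%MM = wdot y a * N%:R.
    by rewrite mulr_suml; apply: eq_bigr => i _; rewrite mulmnE natrM mulrA.
  by move=> a1; rewrite ler_peMl.
apply: (@determinant_trick {mpoly k[n]} monomial_ideal f #|S|
  (\matrix_(i, j) B (enum_val i) (enum_val j)) (\col_i u (enum_val i))).
- by move=> i j; rewrite mxE; have [] := BP (enum_val i).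
- apply/eqP => /matrixP/(_ (enum_rank s0) 0); rewrite !mxE => /eqP.
  by apply/negP; rewrite -msupp_eq0 msuppX.
- apply/matrixP => i j; rewrite !mxE; have [_ ->] := BP (enum_val i).
  rewrite [RHS](reindex (fun l : 'I_#|S| => enum_val l)) /=; last first.
    by apply: onW_bij; apply: enum_val_bij.
  by apply: eq_bigr => l _; rewrite !mxE.
Qed.

(** Let [f0] be the part of [f] of least value [t] under a valuation that is at
    least one on the ideal. If [t < 1], then [f0 ^+ M] is the part of value
    [M * t] of an equation of integral dependence of degree [M] in which all
    other terms have greater value; so [f0] is nilpotent. *)
Lemma integral_newton f : integral_closure monomial_ideal f ->
  supported (newton 1) f.
Proof.
move=> [M [a [M0 aI fM]]] m mf y yB; rewrite leNgt; apply/negP => m1.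
have [m0 m0f m0min] := seq_argmin (wdot y) mf.
set t := wdot y m0 in m0min; have t1 : t < 1 by exact: le_lt_trans (m0min m mf) m1.
pose ge s := supported (k := k) (fun m => s <= wdot y m).
pose gt s := supported (k := k) (fun m => s < wdot y m).
pose eq s := supported (k := k) (fun m => wdot y m = s).
have geM s s' p q : ge s p -> ge s' q -> ge (s + s') (p * q).
  by apply: supportedM => b c; rewrite wdotD; exact: lerD.
have gtM s s' p q : gt s p -> ge s' q -> gt (s + s') (p * q).
  by apply: supportedM => b c; rewrite wdotD; exact: ltr_leD.
have eqM s s' p q : eq s p -> eq s' q -> eq (s + s') (p * q).
  by apply: supportedM => b c; rewrite wdotD => -> ->.
have eqge s p : eq s p -> ge s p by move=> pe b /pe ->.
have ge1 : ge 0 1 by move=> b; rewrite msupp1 inE => /eqP ->; rewrite wdot0.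
have supported_ideal s G p : (forall q, G q -> ge s q) -> ideal_gen G p -> ge s p.
  move=> Gs [r [rG ->]]; rewrite big_seq; apply: supported_sum => q /rG/Gs qs.
  rewrite -[s]add0r; apply: geM => // b _; exact: wdot_ge0 yB.1.
have geI i p : ideal_pow monomial_ideal i p -> ge i%:R p.
  apply: (supported_ideal) => _ [c [cI ->]].
  have : forall F : 'I_i -> {mpoly k[n]},
      (forall j, ge 1 (F j)) -> ge i%:R (\prod_j F j).
    elim: i {c cI} => [|i IHi] F FI; first by rewrite big_ord0.
    rewrite big_ord_recr -natr1; apply: geM => //.
    by apply: IHi => j; exact: FI.
  apply=> j; apply: supported_ideal (cI j) => _ [e ->] b.
  by rewrite msuppX inE => /eqP ->; case: yB.
have geX p s j : ge s p -> ge (j%:R * s) (p ^+ j).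
  move=> ps; elim: j => [|j IHj]; first by rewrite mul0r.
  by rewrite exprS -add1n natrD mulrDl mul1r; exact: geM.
have fge : ge t f by move=> b /m0min.
pose f0 := \sum_(b <- msupp f | wdot y b == t) f@_b *: 'X_[b].
pose f1 := \sum_(b <- msupp f | wdot y b != t) f@_b *: 'X_[b].
have fE : f = f0 + f1 by rewrite [LHS]mpolyE (bigID (fun b => wdot y b == t)).
have f0t : eq t f0 by apply: supported_sum => b /eqP bt; exact: supportedZX.
have f1t : gt t f1.
  rewrite /f1 big_seq_cond; apply: supported_sum => b /andP[bf bt].
  by apply: supportedZX; rewrite lt_neqAle eq_sym bt m0min.
have f0X j : eq (j%:R * t) (f0 ^+ j).
  elim: j => [|j IHj].
    move=> b; rewrite msupp1 inE mul0r => /eqP ->; exact: wdot0.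
  by rewrite exprS -add1n natrD mulrDl mul1r; exact: eqM.
have fX j : gt (j%:R * t) (f ^+ j - f0 ^+ j).
  elim: j => [|j IHj]; first by rewrite subrr; exact: supported0.
  have -> : f ^+ j.+1 - f0 ^+ j.+1 = (f ^+ j - f0 ^+ j) * f0 + f1 * f ^+ j.
    have -> : f1 = f - f0 by rewrite fE addrC addKr.
    by rewrite !exprS; ring.
  apply: supportedD; first by rewrite -natr1 mulrDl mul1r; apply: gtM => //; exact: eqge.
  by rewrite -add1n natrD mulrDl mul1r; apply: gtM => //; exact: geX.
have /eqP : f0 ^+ M = 0.
  apply/eqP; rewrite -msupp_eq0.
  have f0gt : gt (M%:R * t) (f0 ^+ M).
    have -> : f0 ^+ M = - ((f ^+ M - f0 ^+ M) +
        \sum_(1 <= i < M.+1) a i * f ^+ (M - i)).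
      by rewrite addrAC fM sub0r opprK.
    apply: supportedN; apply: supportedD; first exact: fX.
    rewrite big_nat_cond; apply: supported_sum => i /andP[/andP[i1 iM] _].
    have Mt : M%:R * t < i%:R + (M - i)%:R * t.
      rewrite natrB // mulrBl addrCA ltrDl subr_gt0 -[ltRHS]mulr1.
      by rewrite ltr_pM2l ?ltr0n.
    move=> b bs; apply: lt_le_trans Mt _.
    by apply: geM bs; [apply/geI/aI; rewrite i1 -ltnS|exact: geX].
  case sE : (msupp (f0 ^+ M)) => [//|b s].
  have bs : b \in msupp (f0 ^+ M) by rewrite sE mem_head.
  by have := f0gt b bs; rewrite (f0X M b bs) ltxx.
rewrite expf_eq0 M0 => /eqP f00.
by have := f1t m0; rewrite -[f1]add0r -f00 -fE => /(_ m0f); rewrite ltxx.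
Qed.

End MonomialIdeals.

(** * Monomial valuations of a weighted tournament *)

(** Laurent monomials over a common denominator: [b] stands for the exponent
    [b - (N, ..., N)], and the condition is membership in the localization at
    the variables of [F] of the monomial ideal with exponent set [P]. *)
Definition in_loc n (P : 'X_{1..n} -> Prop) (N : nat) (F : {set 'I_n})
    (b : 'X_{1..n}) :=
  exists N' m, P m /\
    forall i, (m i + N = b i + (if i \in F then N' else 0))%N.

Section Tournament.
Variables (n : nat) (D : wo_complete_graph n).
Implicit Types (y : 'I_n -> rat) (m b c : 'X_{1..n}) (i j v : 'I_n)
  (N : nat) (F : {set 'I_n}).

Local Notation w := (weight D).
Local Notation W := (\max_(j < n) weight D j)%N.

Definition arc := {p : 'I_n * 'I_n | edge D p.1 p.2}.

Definition arc_mon (e : arc) : 'X_{1..n} :=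
  (U_((val e).1) + U_((val e).2) *+ w (val e).2)%MM.

Local Notation inJ := (newton arc_mon 1).

Lemma wdot_arc y i j : wdot y (U_(i) + U_(j) *+ w j)%MM = y i + (w j)%:R * y j.
Proof.
have wdotU l : wdot y U_(l)%MM = y l.
  rewrite /wdot (bigD1 l) //= mnm1E eqxx mulr1 big1 ?addr0 // => i' /negPf il.
  by rewrite mnm1E eq_sym il mulr0.
rewrite wdotD wdotU; congr (_ + _); rewrite -[in RHS]wdotU mulr_sumr.
by apply: eq_bigr => l _; rewrite mulmnE natrM mulrA mulrC.
Qed.

Lemma blocking_arcP y : blocking arc_mon y <->
  (forall i, 0 <= y i) /\ forall i j, edge D i j -> 1 <= y i + (w j)%:R * y j.
Proof.
split=> -[y0 yE]; split=> //.
  by move=> i j eij; rewrite -wdot_arc; exact: (yE (exist _ (i, j) eij)).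
by move=> [[i j] /= eij]; rewrite wdot_arc; exact: yE.
Qed.

Lemma edgeN i j : i != j -> edge D j i = ~~ edge D i j.
Proof. by move=> /(edge_oriented D); case: edge; case: edge. Qed.

Lemma weight_le i : (w i <= W)%N.
Proof. exact: leq_bigmax. Qed.

(** Inverting [x_v] turns the ideal into one generated by powers of the
    remaining variables, [x_i] for [i -> v] and [x_i ^ w i] for [v -> i]; this
    is the valuation that decides membership in its integral closure. *)
Definition link_val v i : rat :=
  if i == v then 0 else if edge D i v then 1 else (w i)%:R^-1.

Lemma link_val_ge0 v i : 0 <= link_val v i.
Proof. by rewrite /link_val; case: eqP => // _; case: ifP => // _; rewrite invr_ge0. Qed.

Lemma link_val_blocking v : blocking arc_mon (link_val v).
Proof.
apply/blocking_arcP; split=> [i|i j eij]; first exact: link_val_ge0.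
have w0 l : 1 <= (w l)%:R :> rat by rewrite ler1n weight_gt0.
have w0' l : 0 < (w l)%:R :> rat by rewrite ltr0n weight_gt0.
rewrite {2}/link_val; have [jv|jv] := eqVneq j v.
  subst j; rewrite /link_val eij; case: eqP => [iv|_]; last by rewrite mulr0 addr0.
  by move: eij; rewrite iv (negPf (edge_irrefl D v)).
have i0 := link_val_ge0 v i.
case: ifP => ejv; last by rewrite mulfV ?gt_eqF // lerDr.
by rewrite mulr1; have := w0 j; lra.
Qed.

Lemma inJ_link v m : inJ m -> 1 <= wdot (link_val v) m.
Proof. by apply; exact: link_val_blocking. Qed.

Lemma eq_wdot_link v m m' : (forall i, i != v -> m i = m' i) ->
  wdot (link_val v) m = wdot (link_val v) m'.
Proof.
move=> mm'; apply: eq_bigr => i _; have [->|iv] := eqVneq i v.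
  by rewrite /link_val eqxx !mul0r.
by rewrite mm'.
Qed.

(** Let [y] be a valuation and [t = y v]. If [w v * t >= 1], the factor
    [x_v ^ w v] suffices; otherwise the arcs at [v] give
    [y >= (1 - w v * t) * link_val v] away from [v]. *)
Lemma link_inJ v m : 1 <= wdot (link_val v) m -> (w v <= m v)%N -> inJ m.
Proof.
move=> loc wm y /blocking_arcP[y0 yE]; set t := y v.
have wm' : (w v)%:R <= (m v)%:R :> rat by rewrite ler_nat.
have w1 i : 1 <= (w i)%:R :> rat by rewrite ler1n weight_gt0.
have w0 i : 0 < (w i)%:R :> rat by rewrite ltr0n weight_gt0.
have t0 : 0 <= t by exact: y0.
have sum0 : 0 <= \sum_(i | i != v) y i * (m i)%:R.
  by apply: sumr_ge0 => i _; rewrite mulr_ge0.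
have tm : (w v)%:R * t <= t * (m v)%:R by rewrite mulrC ler_wpM2l.
rewrite /wdot (bigD1 v) //= -/t.
have [wt|wt] := lerP 1 ((w v)%:R * t); first by lra.
apply: (@le_trans _ _ ((w v)%:R * t + (1 - (w v)%:R * t) * wdot (link_val v) m)).
  have := @ler_wpM2l _ (1 - (w v)%:R * t) _ _ _ loc; rewrite mulr1.
  by move=> /(_ ltac:(lra)); lra.
apply: lerD => //; rewrite /wdot (bigD1 v) //= {1}/link_val eqxx mul0r add0r mulr_sumr.
apply: ler_sum => i iv; rewrite mulrA ler_wpM2r // /link_val (negPf iv).
case: ifP => eiv; first by have := yE _ _ eiv; rewrite -/t; lra.
have evi : edge D v i by rewrite edgeN // eiv.
rewrite ler_pdivrMr // mulrC; have := yE _ _ evi; rewrite -/t.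
have := ler_wpM2r t0 (w1 v); lra.
Qed.

(** For a blocking valuation [y], either all [y i] are at least [1/(W+1)], or
    some [y p] is smaller; in the latter case [y] dominates the convex
    combination of [link_val p] and the constant valuation [1/(W+1)] that has
    the value [y p] at [p]. *)
Lemma links_inJ m : (forall v, 1 <= wdot (link_val v) m) -> (W < mdeg m)%N -> inJ m.
Proof.
move=> loc Wm y /blocking_arcP[y0 yE].
have degE t : \sum_i t * (m i)%:R = t * (mdeg m)%:R :> rat.
  by rewrite -mulr_sumr mdegE natr_sum.
have WmR : W%:R + 1 <= (mdeg m)%:R :> rat by rewrite natr1 ler_nat.
have W0 : 0 <= W%:R :> rat by rewrite ler0n.
case: (boolP [exists p, y p * (W%:R + 1) < 1]) => [/existsP[p yp]|/existsPn yW].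
  set t := y p in yp; have t0 : 0 <= t := y0 p.
  have Wt := mulr_ge0 t0 W0.
  apply: (@le_trans _ _ ((1 - t * (W%:R + 1)) * wdot (link_val p) m + t * (mdeg m)%:R)).
    have := @ler_wpM2l _ (1 - t * (W%:R + 1)) _ _ _ (loc p); rewrite mulr1.
    have := ler_wpM2l t0 WmR; move=> h /(_ ltac:(lra)); lra.
  rewrite -degE mulr_sumr -big_split; apply: ler_sum => i _ /=.
  rewrite mulrA -mulrDl ler_wpM2r // /link_val; have [->|ip] := eqVneq i p.
    by rewrite mulr0 add0r.
  have wW l : (w l)%:R <= W%:R :> rat by rewrite ler_nat weight_le.
  have wi0 : 0 < (w i)%:R :> rat by rewrite ltr0n weight_gt0.
  case: ifP => eip.
    by have := yE _ _ eip; rewrite -/t; have := ler_wpM2l t0 (wW p); lra.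
  have epi : edge D p i by rewrite edgeN // eip.
  rewrite -(ler_pM2r wi0) mulrDl -mulrA mulVf ?gt_eqF //.
  by have := yE _ _ epi; rewrite -/t; have := ler_wpM2l t0 (wW i); lra.
have W1 : 0 < W%:R + 1 :> rat by lra.
rewrite -(ler_pM2r W1) mul1r; apply: (le_trans WmR).
rewrite -[leLHS]mul1r -degE /wdot mulr_suml; apply: ler_sum => i _.
by rewrite mulrAC ler_wpM2r // leNgt.
Qed.

(** Every coordinate of [link_val v] other than that at [v] is at least [1/W]. *)
Lemma link_lt1_deg v c : wdot (link_val v) c < 1 -> (\sum_(i | i != v) c i < W)%N.
Proof.
move=> loc; have W0 : 0 < W%:R :> rat.
  by rewrite ltr0n (leq_trans _ (weight_le v)) // weight_gt0.
rewrite -(ltr_nat rat) natr_sum -[ltRHS]mul1r -ltr_pdivrMr //.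
apply: le_lt_trans loc; rewrite /wdot [leRHS](bigD1 v) //= {1}/link_val eqxx mul0r add0r.
rewrite mulr_suml; apply: ler_sum => i iv.
rewrite mulrC ler_wpM2r // /link_val (negPf iv).
have wi0 : 0 < (w i)%:R :> rat by rewrite ltr0n weight_gt0.
case: ifP => _; last by rewrite lef_pV2 ?posrE // ler_nat weight_le.
by rewrite invf_le1 // ler1n -(ltr0n rat).
Qed.

(** If [v -> v'], then [link_val v'] is one at [v], so that [c v = 0] and the
    bound of [link_lt1_deg] for [v] applies to the whole degree. *)
Lemma two_links_lt1_deg v v' c : v != v' ->
  wdot (link_val v) c < 1 -> wdot (link_val v') c < 1 -> (mdeg c < W)%N.
Proof.
wlog evv' : v v' / edge D v v' => [H vv' lv lv'|vv' lv lv'].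
  case: (boolP (edge D v v')) => e; first exact: (H v v').
  by apply: (H v' v) => //; rewrite 1?eq_sym // edgeN.
have cv : c v = 0%N.
  apply/eqP; rewrite -leqn0 -ltnS -(ltr_nat rat); apply: le_lt_trans lv'.
  rewrite /wdot (bigD1 v) //= {1}/link_val (negPf vv') evv' mul1r lerDl.
  by apply: sumr_ge0 => i _; rewrite mulr_ge0 // link_val_ge0.
by rewrite mdegE (bigD1 v) //= cv add0n; exact: link_lt1_deg.
Qed.

Lemma in_loc_neg N F b i : in_loc inJ N F b -> (b i < N)%N -> i \in F.
Proof.
move=> [N' [m [_ mE]]] bN; apply: contraLR bN => iF; rewrite -leqNgt.
by have := mE i; rewrite (negPf iF) addn0 => <-; exact: leq_addl.
Qed.

Lemma in_loc_card2 N F b : (1 < #|F|)%N -> (forall i, (b i < N)%N -> i \in F) ->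
  in_loc inJ N F b.
Proof.
move=> /card_gt1P[u [v [uF vF uv]]] neg.
pose m := [multinom (b i + (if i \in F then N + W else 0) - N)%N | i < n].
exists (N + W)%N, m; split; last first.
  move=> i; rewrite mnmE subnK //; case: ifP => iF; first by lia.
  by rewrite addn0 leqNgt; apply: contraFN iF; exact: neg.
wlog euv : u v uF vF uv / edge D u v => [H|].
  case: (boolP (edge D u v)) => e; first exact: (H u v).
  by apply: (H v u) => //; rewrite 1?eq_sym // edgeN.
move=> y /blocking_arcP[y0 yE]; apply: (le_trans (yE _ _ euv)).
have mW l : l \in F -> (w l)%:R <= (m l)%:R :> rat.
  by move=> lF; rewrite ler_nat mnmE lF; have := weight_le l; lia.
have w1 : 1 <= (w u)%:R :> rat by rewrite ler1n weight_gt0.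
rewrite /wdot (bigD1 u) //= (bigD1 v) 1?eq_sym //=.
have : 0 <= \sum_(i | (i != u) && (i != v)) y i * (m i)%:R.
  by apply: sumr_ge0 => i _; rewrite mulr_ge0.
have := ler_wpM2l (y0 v) (mW v vF); have := ler_wpM2l (y0 u) (mW u uF).
have := ler_wpM2l (y0 u) w1; lra.
Qed.

Lemma in_loc1 N v b : in_loc inJ N [set v] b <-> (forall i, i != v -> (N <= b i)%N) /\
  1 <= wdot (link_val v) [multinom (b i - N)%N | i < n].
Proof.
split=> [bU|[bN loc]].
  split=> [i iv|].
    by rewrite leqNgt; apply: contra iv => /(in_loc_neg bU); rewrite inE.
  have [N' [m [mJ mE]]] := bU; have := inJ_link v mJ.
  rewrite (@eq_wdot_link _ m [multinom (b i - N)%N | i < n]) // => i iv.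
  by rewrite mnmE; have := mE i; rewrite inE (negPf iv); lia.
pose m := [multinom (b i + (if i \in [set v] then N + w v else 0) - N)%N | i < n].
exists (N + w v)%N, m; split; last first.
  move=> i; rewrite mnmE inE subnK //; have [//|/bN] := eqVneq i v; lia.
apply: (link_inJ (v := v)); last by rewrite mnmE inE eqxx; lia.
rewrite (@eq_wdot_link _ m [multinom (b i - N)%N | i < n]) // => i iv.
by rewrite !mnmE inE (negPf iv) addn0.
Qed.

Lemma in_loc0 N b : inJ [multinom (b i - N)%N | i < n] ->
  (forall i, (N <= b i)%N) -> in_loc inJ N set0 b.
Proof.
move=> bJ bN; exists 0%N, [multinom (b i - N)%N | i < n]; split=> // i.
by rewrite mnmE if_same addn0 subnK.
Qed.

Lemma mdeg_shift N b : (forall i, (N <= b i)%N) ->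
  (mdeg b = mdeg [multinom (b i - N)%N | i < n] + n * N)%N.
Proof.
move=> bN; rewrite !mdegE -[in (n * N)%N](card_ord n) -sum_nat_const -big_split /=.
by apply: eq_bigr => i _; rewrite mnmE subnK.
Qed.

(** Removal of [v] is required to preserve the family only for sets of [i]
    elements: this is what the contraction onto [v] uses in cohomological
    degree [i]. *)
Lemma cone_vertex N b (i : nat) : (0 < i <= n)%N -> (n * N + W + 1 < mdeg b + i)%N ->
  exists v, forall F, #|F|.+1 = i -> v \notin F ->
    in_loc inJ N (v |: F) b -> in_loc inJ N F b.
Proof.
move=> /andP[i0 il] big_deg.
have [v0 bv0] : exists v0, (N <= b v0)%N.
  case: (boolP [exists v0, N <= b v0]%N) => [/existsP//|/existsPn bN].
  have : (\sum_i (b i + 1) <= \sum_(i < n) N)%N.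
    by apply: leq_sum => v _; have := bN v; rewrite -ltnNge addn1.
  by rewrite big_split /= -mdegE !sum_nat_const card_ord muln1; lia.
have pos_dec : (forall v, (N <= b v)%N) \/ exists g, (b g < N)%N.
  case: (boolP [forall v, N <= b v]%N) => [/forallP|/forallPn[g]]; first by left.
  by rewrite -ltnNge; right; exists g.
have neg_ne g : (b g < N)%N -> g != v0.
  by move=> bg; apply: contraTneq bg => ->; rewrite -leqNgt.
(* With three or more elements, [in_loc_card2] applies to the smaller set. With
   two, [v] must be the only vertex at which localization fails; with one, such
   a vertex or else [links_inJ]. A negative exponent at [g] forces [g] into all
   sets of the family and [v0] serves. *)
have [i1|i2|i3] : [\/ i = 1%N, i = 2%N | (2 < i)%N].
- by case: i i0 {il big_deg} => [|[|[|i]]] // _; [constructor 1|constructor 2|constructor 3].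
- subst i; case: pos_dec => [bN|[g bg]]; last first.
    exists v0 => F [] /eqP; rewrite cards_eq0 => /eqP -> _ /in_loc_neg/(_ bg).
    by rewrite setU0 inE (negPf (neg_ne g bg)).
  set c := [multinom (b i - N)%N | i < n].
  case: (boolP [exists v, wdot (link_val v) c < 1]) => [/existsP[v lv]|/existsPn lN].
    exists v => F [] /eqP; rewrite cards_eq0 => /eqP -> _.
    by rewrite setU0 => /in_loc1[_]; rewrite leNgt lv.
  exists v0 => F [] /eqP; rewrite cards_eq0 => /eqP -> _ _.
  apply: in_loc0 => //; apply: links_inJ => [v|]; first by rewrite leNgt.
  by have := mdeg_shift bN; rewrite -/c; lia.
- subst i; case: pos_dec => [bN|[g bg]].
    set c := [multinom (b i - N)%N | i < n].
    have [v vP] : exists v, forall u, u != v -> 1 <= wdot (link_val u) c.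
      case: (boolP [exists v, wdot (link_val v) c < 1]) => [/existsP[v lv]|/existsPn lN].
        exists v => u uv; rewrite leNgt; apply/negP => lu.
        have := two_links_lt1_deg uv lu lv.
        by have := mdeg_shift bN; rewrite -/c; lia.
      by exists v0 => u _; rewrite leNgt.
    exists v => F [] /eqP/cards1P[u ->]; rewrite inE => vu _.
    by apply/in_loc1; split=> //; apply: vP; rewrite eq_sym.
  case: (boolP [exists g', (g' != g) && (b g' < N)%N]).
    move=> /existsP[g' /andP[gg' bg']].
    exists v0 => F [] /eqP/cards1P[u ->] _ bU.
    have := in_loc_neg bU bg; have := in_loc_neg bU bg'; rewrite !inE.
    rewrite (negPf (neg_ne _ bg)) (negPf (neg_ne _ bg')) /= => /eqP g'u /eqP gu.
    by rewrite g'u gu eqxx in gg'.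
  move=> /existsPn bN; exists v0 => F [] /eqP/cards1P[u ->] _ /in_loc_neg/(_ bg).
  rewrite !inE (negPf (neg_ne _ bg)) /= => /eqP <-.
  have bN' v : v != g -> (N <= b v)%N.
    by move=> vg; have := bN v; rewrite vg /= -leqNgt.
  apply/in_loc1; split=> //; rewrite leNgt; apply/negP => /link_lt1_deg.
  have : (\sum_(v | v != g) b v =
      \sum_(v | v != g) [multinom (b i - N)%N | i < n] v + n.-1 * N)%N.
    have <- : (\sum_(v | v != g) N = n.-1 * N)%N.
      by rewrite sum_nat_const cardC1 card_ord.
    by rewrite -big_split; apply: eq_bigr => v vg /=; rewrite mnmE subnK // bN'.
  have n0 : (0 < n)%N by have := ltn_ord g; lia.
  have dE : mdeg b = (b g + \sum_(v | v != g) b v)%N by rewrite mdegE (bigD1 g).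
  by move: big_deg; rewrite dE -[in (n * N)%N](prednK n0) mulSn; lia.
- exists v0 => F Fi v0F bU; apply: in_loc_card2 => [|j bj]; first by lia.
  by have := in_loc_neg bU bj; rewrite !inE (negPf (neg_ne j bj)).
Qed.

End Tournament.

(** * The contraction of a simplex *)

Section Coboundary.
Variables (n : nat) (A : comNzRingType).
Implicit Types (F : {set 'I_n}) (u v : 'I_n) (c : {set 'I_n} -> A).

Definition pos F v := #|[set u in F | (u < v)%N]|.

Lemma pos_rem F u v : u \in F -> pos F v = (pos (F :\ u) v + (u < v)%N)%N.
Proof.
move=> uF; rewrite /pos (cardsD1 u) inE uF /= addnC; congr (_ + _)%N.
by apply: eq_card => x; rewrite !inE andbA.
Qed.

Definition cobd c F : A := \sum_(v in F) (-1) ^+ pos F v * c (F :\ v).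

(** The homotopy between the identity and zero on the cochains of the full
    simplex, given by the vertex [v]. *)
Definition contract v c F : A :=
  if v \in F then 0 else (-1) ^+ pos F v * c (v |: F).

Lemma cobd_contract v c F : (forall F', cobd c F' = 0) ->
  cobd (contract v c) F = c F.
Proof.
move=> c0; rewrite /cobd /contract; have [vF|vF] := boolP (v \in F).
  rewrite (bigD1 v) //= big1 => [|u /andP[uF uv]]; last first.
    by rewrite !inE vF eq_sym uv /= mulr0.
  rewrite !inE eqxx /= setD1K // (pos_rem v vF) ltnn addn0 addr0 mulrA.
  by rewrite -exprD addnn -mul2n exprM sqrrN expr1n expr1n mul1r.
have := c0 (v |: F); rewrite /cobd big_setU1 //= setU1K // => /eqP.
have := pos_rem v (setU11 v F); rewrite setU1K // ltnn addn0 => ->.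
rewrite addrC addr_eq0 => /eqP cF.
rewrite -[RHS](signrMK (pos F v)) -[_ * c F]opprK -cF mulrN mulr_sumr -sumrN.
apply: eq_bigr => u uF; rewrite !inE (negPf vF) andbF.
have uv : u != v by apply: contraNneq vF => <-.
have -> : (v |: F) :\ u = v |: (F :\ u).
  apply/setP => x; rewrite !inE; have [->|//] := eqVneq x v.
  by rewrite eq_sym uv.
have -> : pos (v |: F) u = (pos F u + (v < u)%N)%N.
  by rewrite (pos_rem _ (setU11 v F)) setU1K.
rewrite (pos_rem v uF) !mulrA -!exprD -mulNr; congr (_ * _).
have -> : (pos (F :\ u) v + (u < v) + (pos F u + (v < u)) =
    (pos F u + pos (F :\ u) v).+1)%N.
  by have [uv'|uv'|/val_inj uv'] := ltngtP u v; [lia..|rewrite uv' eqxx in uv].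
by rewrite exprS mulN1r opprK.
Qed.

Lemma cobd_cobd c F : cobd (cobd c) F = 0.
Proof.
pose T u v := (-1) ^+ pos F u * ((-1) ^+ pos (F :\ u) v * c (F :\ u :\ v)) : A.
have anti u v : u \in F -> v \in F -> (u < v)%N -> T v u = - T u v.
  move=> uF vF uv; rewrite /T setDDl setUC -setDDl !mulrA -!exprD -mulNr.
  congr (_ * _); rewrite (pos_rem v uF) (pos_rem u vF) uv ltnNge (ltnW uv) /=.
  by rewrite addn0 addn1 addSn exprS mulN1r addnC.
have -> : cobd (cobd c) F =
    \sum_(u in F) (\sum_(v in F | (v < u)%N) T u v + \sum_(v in F | (u < v)%N) T u v).
  apply: eq_bigr => u uF; rewrite mulr_sumr (bigID (fun v : 'I_n => v < u)%N) /=.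
  congr (_ + _); apply: eq_bigl => v; rewrite !inE -?leqNgt -val_eqE /=;
    by case: ltngtP; rewrite ?andbF ?andbT.
rewrite big_split /=.
rewrite [X in _ + X](exchange_big_dep (mem F)) /= => [|u v _ /andP[]//].
rewrite -big_split big1 // => u uF /=.
rewrite [X in _ + X](eq_bigl (fun v => (v \in F) && (v < u)%N)); last first.
  by move=> v; rewrite uF.
rewrite -big_split big1 // => v /andP[vF vu].
by rewrite /= (anti v u) // addNr.
Qed.

End Coboundary.

Lemma raddf_cobd n (A B : comNzRingType) (f : {additive A -> B})
    (c : {set 'I_n} -> A) F : f (cobd c F) = cobd (f \o c) F.
Proof.
by rewrite raddf_sum; apply: eq_bigr => v _; rewrite raddfMsign.
Qed.

(** * Cech complexes of monomial ideals *)

Section MonomialCech.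
Variables (k : fieldType) (n : nat).
Variables (J : {mpoly k[n]} -> Prop) (P : 'X_{1..n} -> Prop).
Hypothesis JP : forall f, J f <-> supported P f.
Hypothesis P_up : forall m m', P m -> P (m + m')%MM.
Implicit Types (F : {set 'I_n}) (j : int) (b m : 'X_{1..n}).

Local Notation frac := {fraction {mpoly k[n]}}.

Definition expo F : 'X_{1..n} := [multinom (v \in F : nat) | v < n].

Lemma varprodX F N : varprod k F ^+ N = 'X_[expo F *+ N].
Proof.
rewrite -mpolyXn; congr (_ ^+ _); rewrite /varprod mprodXE; congr 'X_[_].
apply/mnmP => i; rewrite mnm_sumE mnmE; have [iF|iF] := boolP (i \in F).
  rewrite (bigD1 i) //= mnm1E eqxx big1 // => v /andP[_ vi].
  by rewrite mnm1E (negPf vi).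
rewrite big1 // => v vF; rewrite mnm1E; case: eqP => // vi.
by rewrite vi (negPf iF) in vF.
Qed.

Lemma mdeg_expo F N : mdeg (expo F *+ N)%MM = (#|F| * N)%N.
Proof.
rewrite mdegMn mdegE -sum1_card [in RHS]big_mkcond /=; congr (_ * _)%N.
by apply: eq_bigr => i _; rewrite mnmE; case: (i \in F).
Qed.

Lemma fracX_neq0 m : tofrac ('X_[m] : {mpoly k[n]}) != 0.
Proof. by rewrite tofrac_eq0 -msupp_eq0 msuppX. Qed.

(** Numerators of the elements of the component at [F], over the [N]-th power of
    the product of all the variables. This denominator can be shared by all the
    components of a cochain. *)
Definition numer N F j (g : {mpoly k[n]}) :=
  forall b, b \in msupp g -> in_loc P N F b /\ (mdeg b)%:Z = j + (n * N)%:Z.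

Definition with_denom N (g : {mpoly k[n]}) : frac :=
  tofrac g / tofrac 'X_[expo setT *+ N].

Lemma loc_degD F j z z' : loc_deg J F j z -> loc_deg J F j z' ->
  loc_deg J F j (z + z').
Proof.
move=> [N [f [/JP fJ fj ->]]] [N' [f' [/JP fJ' fj' ->]]].
exists (N + N')%N, (f * 'X_[expo F *+ N'] + f' * 'X_[expo F *+ N]).
have XP h M : supported P h -> supported P (h * 'X_[expo F *+ M]).
  move=> hP; apply: (supportedM (Q := fun=> True)) hP _ => // a b Pa _.
  exact: P_up.
have Xdeg h M M' : homog_of_deg (j + (M * #|F|)%:Z) h ->
    supported (fun m => (mdeg m)%:Z = j + ((M + M') * #|F|)%:Z) (h * 'X_[expo F *+ M']).
  move=> hj; apply: (supportedM (Q := eq (expo F *+ M')%MM)) hj _ => [a b aj <-|b].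
    by rewrite mdegD mdeg_expo; lia.
  by rewrite msuppX inE => /eqP.
split.
- by apply/JP; apply: supportedD; exact: XP.
- by apply: supportedD; [exact: Xdeg|rewrite addnC; exact: Xdeg].
rewrite -!tofracXn !varprodX -!mpolyXn exprD rmorphD !rmorphM /=.
rewrite addf_div ?mulf_neq0 // -?mpolyXn ?rmorphXn ?expf_neq0 ?fracX_neq0 //.
Qed.

Lemma loc_deg0 F j : loc_deg J F j 0.
Proof.
exists 0%N, 0; split; [by apply/JP; exact: supported0| |by rewrite rmorph0 mul0r].
by move=> m; rewrite msupp0.
Qed.

Lemma loc_deg_numer N F j g : numer N F j g -> loc_deg J F j (with_denom N g).
Proof.
move=> gP; rewrite /with_denom [g]mpolyE raddf_sum mulr_suml big_seq /=.
elim/big_ind: _ => [||b /gP[[N' [m [mP mE]]] bj]]; first exact: loc_deg0.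
  by move=> z z'; exact: loc_degD.
exists N', (g@_b *: 'X_[m]); split.
- by apply/JP; exact: supportedZX.
- apply: supportedZX; have : mdeg (m + expo setT *+ N)%MM = mdeg (b + expo F *+ N')%MM.
    congr mdeg; apply/mnmP => i; rewrite !mnmDE !mulmnE !mnmE inE mul1n mE.
    by case: (i \in F); rewrite ?mul1n ?mul0n.
  by rewrite !mdegD !mdeg_expo cardsT card_ord; lia.
rewrite -tofracXn varprodX; apply/eqP; rewrite eqr_div ?fracX_neq0 //.
rewrite -!rmorphM -!scalerAl -!mpolyXD /=; apply/eqP; congr (tofrac (_ *: 'X_[_])).
apply/mnmP => i; rewrite !mnmDE !mulmnE !mnmE inE mul1n mE.
by case: (i \in F); rewrite ?mul1n ?mul0n.
Qed.

Lemma numer_loc_deg F j z : loc_deg J F j z ->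
  exists N0, forall N, (N0 <= N)%N -> exists2 g, numer N F j g & z = with_denom N g.
Proof.
move=> [N0 [f [/JP fP fj ->]]]; exists N0 => N N0N.
pose r : 'X_{1..n} := [multinom (if v \in F then N - N0 else N)%N | v < n].
have rE : (r + expo F *+ N0 = expo setT *+ N)%MM.
  apply/mnmP => i; rewrite !mnmDE !mulmnE !mnmE inE; case: (i \in F); lia.
exists (f * 'X_[r]); last first.
  rewrite /with_denom -tofracXn varprodX -rE mpolyXD !rmorphM /=.
  apply/eqP; rewrite eqr_div ?mulf_neq0 ?fracX_neq0 //.
  by rewrite mulrA.
apply: (supportedM (P := fun m => P m /\ (mdeg m)%:Z = j + (N0 * #|F|)%:Z)
  (Q := eq r)) => [a b [aP aj] <-|m mf|b]; first 1 last.
- by split; [exact: fP|exact: fj].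
- by rewrite msuppX inE => /eqP.
split.
  exists N0, a; split=> // i; rewrite mnmDE !mnmE.
  by case: (i \in F); lia.
have := congr1 (@mdeg n) rE; rewrite !mdegD !mdeg_expo cardsT card_ord.
by lia.
Qed.

Lemma cech_numer i j c : cech J i j c -> exists N, exists g : {set 'I_n} -> {mpoly k[n]},
  forall F, c F = with_denom N (g F) /\
    forall b, b \in msupp (g F) ->
      [/\ #|F| = i, in_loc P N F b & (mdeg b)%:Z = j + (n * N)%:Z].
Proof.
move=> cJ.
have /fin_all_exists[N0 N0P] : forall F, exists N0, forall N, (N0 <= N)%N -> exists g,
    c F = with_denom N g /\ forall b, b \in msupp g ->
      [/\ #|F| = i, in_loc P N F b & (mdeg b)%:Z = j + (n * N)%:Z].
  move=> F; have := cJ F; case: eqP => [Fi /numer_loc_deg[N0 N0P]|_ ->].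
    exists N0 => N /N0P[g gP ->]; exists g; split=> // b /gP[bU bj]; by split.
  exists 0%N => N _; exists 0; rewrite /with_denom rmorph0 mul0r; split=> // b.
  by rewrite msupp0.
pose N := (\max_F N0 F)%N; exists N.
have /fin_all_exists[g gP] := fun F => N0P F N (leq_bigmax F).
by exists g.
Qed.

Lemma cech_dE N (g : {set 'I_n} -> {mpoly k[n]}) (c : cochain k n) :
  (forall F, c F = with_denom N (g F)) ->
  forall F, cech_d c F = with_denom N (cobd g F).
Proof.
move=> cg F; rewrite ffunE /with_denom raddf_cobd mulr_suml.
by apply: eq_bigr => v _; rewrite cg mulrA.
Qed.

Lemma with_denom_eq0 N g : (with_denom N g == 0) = (g == 0).
Proof. by rewrite mulf_eq0 invr_eq0 (negPf (fracX_neq0 _)) orbF tofrac_eq0. Qed.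

Lemma mcoeff_sumX (s : seq 'X_{1..n}) (a : 'X_{1..n} -> k) b : uniq s ->
  (\sum_(m <- s) a m *: 'X_[m] : {mpoly k[n]})@_b = if b \in s then a b else 0.
Proof.
move=> us; rewrite raddf_sum /=; case: ifP => bs.
  rewrite (bigD1_seq b) //= mcoeffZ mcoeffX eqxx mulr1 big1 ?addr0 // => m /negPf mb.
  by rewrite mcoeffZ mcoeffX mb mulr0.
rewrite big_seq big1 // => m ms; rewrite mcoeffZ mcoeffX.
by case: eqP => [mb|_]; [rewrite mb bs in ms|rewrite mulr0].
Qed.

(** Each monomial part of a cocycle bounds its contraction onto the vertex
    provided by the hypothesis for the multidegree of this part. *)
Lemma cech_acyclic (v0 : 'I_n) i j c :
  (forall N b, (mdeg b)%:Z = j + (n * N)%:Z -> exists v, forall F, #|F|.+1 = i.+1 ->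
    v \notin F -> in_loc P N (v |: F) b -> in_loc P N F b) ->
  cech J i.+1 j c -> cech_d c = 0 -> is_coboundary J i.+1 j c.
Proof.
move=> cone cJ dc0; have [N [g gP]] := cech_numer cJ.
have cg F : c F = with_denom N (g F) by have [] := gP F.
have dg F : cobd g F = 0.
  by apply/eqP; rewrite -(with_denom_eq0 N) -(cech_dE cg) dc0 ffunE.
pose s := undup (flatten [seq msupp (g F) | F : {set 'I_n}]).
have memg F b : b \in msupp (g F) -> b \in s.
  move=> bF; rewrite mem_undup; apply/flattenP; exists (msupp (g F)) => //.
  by apply: map_f; rewrite mem_enum.
have /(seq_choice v0)[vf vfP] : forall b, b \in s -> exists v, forall F, #|F|.+1 = i.+1 ->
    v \notin F -> in_loc P N (v |: F) b -> in_loc P N F b.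
  move=> b; rewrite mem_undup => /flattenP[_ /mapP[F _ ->]] bF; apply: cone.
  by have [_ /(_ b bF)[]] := gP F.
pose h F := \sum_(b <- s) contract (vf b) (fun F => (g F)@_b) F *: 'X_[b].
have hE F b : (h F)@_b = contract (vf b) (fun F => (g F)@_b) F.
  rewrite mcoeff_sumX ?undup_uniq //; case: ifP => // bs.
  rewrite /contract; case: ifP => // _; rewrite memN_msupp_eq0 ?mulr0 //.
  by apply: contraFN bs; exact: memg.
have dh F : cobd h F = g F.
  apply/mpolyP => b; rewrite raddf_cobd /=.
  rewrite -[RHS](@cobd_contract _ _ (vf b) (fun F => (g F)@_b)) => [|F'].
    by apply: eq_bigr => v _; rewrite /= hE.
  by have /(congr1 (mcoeff b)) := dg F'; rewrite raddf_cobd mcoeff0.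
have hP F b : b \in msupp (h F) ->
    [/\ #|F| = i, in_loc P N F b & (mdeg b)%:Z = j + (n * N)%:Z].
  rewrite mcoeff_msupp hE /contract; case: ifPn => vF; first by rewrite eqxx.
  rewrite mulf_eq0 signr_eq0 /= -mcoeff_msupp => bg.
  have [_ /(_ b bg)[]] := gP (vf b |: F); rewrite cardsU1 vF => Fi bU bj.
  split=> //; first by case: Fi.
  by apply: (vfP b (memg _ _ bg)).
exists [ffun F => with_denom N (h F)].
  move=> F; rewrite ffunE; case: eqP => Fi.
    by apply: loc_deg_numer => b /hP[].
  apply/eqP; rewrite with_denom_eq0 -msupp_eq0.
  case sE : (msupp (h F)) => [//|b t].
  by have [] := hP F b; rewrite ?sE ?mem_head.
by apply/ffunP => F; rewrite (@cech_dE N h) ?dh ?cg // => F'; rewrite ffunE.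
Qed.

Lemma cech0_cocycle (v0 : 'I_n) j c : cech J 0 j c -> cech_d c = 0 -> c = 0.
Proof.
move=> cJ /ffunP/(_ [set v0]); rewrite !ffunE big_set1 setDv => c0.
apply/ffunP => F; have := cJ F; rewrite ffunE cards_eq0; case: eqP => // -> _.
by apply/eqP; move/eqP: c0; rewrite mulf_eq0 signr_eq0.
Qed.

Lemma supported_cobd (Q : 'X_{1..n} -> Prop) (g : {set 'I_n} -> {mpoly k[n]}) F :
  (forall v, v \in F -> supported Q (g (F :\ v))) -> supported Q (cobd g F).
Proof.
move=> gQ; rewrite /cobd; apply: supported_sum => v /gQ vQ.
by rewrite -signr_odd mulr_sign; case: odd => //; exact: supportedN.
Qed.

(** The coboundary of the cochain supported at [p] that takes the value [m]
    there lies in the complex because all pairs of variables do; its component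
    at [{p, q}] is a unit times [m], while a primitive would have no monomial
    [m] in either of its components at [p] and [q]. *)
Lemma local_cohomology2_neq0 (m : 'X_{1..n}) (p q : 'I_n) : p != q ->
  (forall F, #|F| = 2%N -> in_loc P 0 F m) ->
  ~ in_loc P 0 [set p] m -> ~ in_loc P 0 [set q] m ->
  local_cohomology_neq0 J 2 (mdeg m)%:Z.
Proof.
move=> pq mU pU qU.
pose d F : {mpoly k[n]} := if F == [set p] then 'X_[m] else 0.
pose c : cochain k n := [ffun F => with_denom 0 (cobd d F)].
have d_supp F : supported (eq m) (d F).
  rewrite /d; case: ifP => _; last exact: supported0.
  by move=> b; rewrite msuppX inE => /eqP.
exists c; split.
- move=> F; rewrite ffunE; case: eqP => F2.
    apply: loc_deg_numer => b bF.
    have <- : m = b by apply: (supported_cobd (fun v _ => d_supp (F :\ v))) bF.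
    split; first exact: mU.
    by rewrite muln0 addr0.
  apply/eqP; rewrite with_denom_eq0; apply/eqP/big1 => v vF; rewrite /d.
  case: eqP => [Fv|_]; last by rewrite mulr0.
  by case: F2; rewrite (cardsD1 v) vF Fv cards1.
- apply/ffunP => F; rewrite (@cech_dE 0 (cobd d)) => [|F']; last by rewrite ffunE.
  by rewrite cobd_cobd /with_denom rmorph0 mul0r ffunE.
move=> [b bJ cb]; have [N [g gP]] := cech_numer bJ.
have bg F : b F = with_denom N (g F) by have [] := gP F.
have gd : cobd g [set p; q] = cobd d [set p; q] * 'X_[expo setT *+ N].
  have /ffunP/(_ [set p; q]) := cb; rewrite ffunE (cech_dE bg) /with_denom.
  rewrite mulm0n mpolyX0 rmorph1 divr1 => /(canLR (mulfVK (fracX_neq0 _))).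
  by rewrite -rmorphM => /eqP; rewrite tofrac_eq => /eqP.
have pqE : [set p; q] :\ p = [set q] by rewrite setU1K // inE.
have qpE : [set p; q] :\ q = [set p] by rewrite setUC setU1K // inE eq_sym.
have supp_g : supported (fun b => in_loc P N [set p] b \/ in_loc P N [set q] b)
    (cobd g [set p; q]).
  apply: supported_cobd => v; rewrite !inE => /orP[] /eqP ->.
    by rewrite pqE => b' /(gP _).2[_ bU _]; right.
  by rewrite qpE => b' /(gP _).2[_ bU _]; left.
(* The shift by [N] in all coordinates cancels against the denominator. *)
have shift v : in_loc P N [set v] (m + expo setT *+ N)%MM -> in_loc P 0 [set v] m.
  move=> [N' [a [aP aE]]]; exists N', a; split=> // i; have := aE i.
  by rewrite !mnmDE mulmnE mnmE inE; lia.
suff : (m + expo setT *+ N)%MM \in msupp (cobd g [set p; q]).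
  by move=> /supp_g[/shift|/shift].
rewrite mcoeff_msupp gd addmC mcoeffMX /cobd big_setU1 ?inE // big_set1 pqE qpE /d eqxx.
rewrite (inj_eq set1_inj) (eq_sym q) (negPf pq) mulr0 /= add0r.
by rewrite -signr_odd mulr_sign; case: odd;
  rewrite ?mcoeffN ?oppr_eq0 mcoeffX eqxx oner_eq0.
Qed.

End MonomialCech.

(** * The regularity *)

Lemma integral_closure_ext (R : comNzRingType) (I I' : R -> Prop) f :
  (forall g, I g -> I' g) -> integral_closure I f -> integral_closure I' f.
Proof.
move=> II' [m [a [m0 aI fE]]]; exists m, a; split=> // i /aI.
apply: ideal_gen_sub => _ [t [tI ->]]; apply: ideal_gen_mem; exists t.
by split=> // k; apply/II'/tI.
Qed.

Lemma integral_closure_edgeP (k : fieldType) n (D : wo_complete_graph n)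
    (f : {mpoly k[n]}) :
  integral_closure (edge_ideal k D) f <-> supported (newton (@arc_mon n D) 1) f.
Proof.
have arcX (i j : 'I_n) : 'X_[U_(i) + U_(j) *+ weight D j]
    = 'X_i * 'X_j ^+ weight D j :> {mpoly k[n]}.
  by rewrite mpolyXD mpolyXn.
split=> [fJ|/newton_integral]; [apply: integral_newton; move: fJ|].
  apply: integral_closure_ext => h; apply: ideal_gen_sub => _ [i [j [ij ->]]].
  by apply: ideal_gen_mem; exists (exist _ (i, j) ij); rewrite -arcX.
apply: integral_closure_ext => h; apply: ideal_gen_sub => _ [[[i j] /= ij] ->].
by apply: ideal_gen_mem; exists i, j; split=> //; rewrite -arcX.
Qed.

Theorem theorem1p3 (k : fieldType) (n : nat) (hn : (2 <= n)%N)
    (D : wo_complete_graph n) :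
  has_reg (integral_closure (edge_ideal k D))
    ((\max_(j < n) weight D j)%N + 1)%:Z.
Proof.
set W := (\max_(j < n) weight D j)%N.
have JP := integral_closure_edgeP (k := k) D.
have P_up m m' : newton (@arc_mon n D) 1 m -> newton (@arc_mon n D) 1 (m + m')%MM.
  move=> mP; rewrite -[1%N]addn0; apply: newtonD => // y [y0 _]; exact: wdot_ge0.
have n0 : (0 < n)%N by exact: ltnW.
split; last first.
  move=> i j [c [cJ dc0 cNB]]; rewrite leNgt; apply/negP => big_deg; apply: cNB.
  case: i => [|i] in cJ big_deg *; first exact: (cech0_cocycle (Ordinal n0) cJ).
  apply: (cech_acyclic JP P_up (Ordinal n0)) cJ dc0 => N b bj.
  have [ni|iN] := ltnP n i.+1.
    (* No set of variables has [i + 1] elements. *)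
    exists (Ordinal n0) => F [Fi] vF; have := subset_leq_card (subsetT (Ordinal n0 |: F)).
    by rewrite cardsU1 vF cardsT card_ord Fi add1n leqNgt ni.
  by apply: cone_vertex => //; rewrite -/W; lia.
have [q qW] : exists q, weight D q = W.
  by have [|q qE] := @bigop.eq_bigmax 'I_n (weight D); [rewrite card_ord|exists q].
have [p [pq pW]] : exists p, p != q /\ (edge D p q \/ W = 1%N).
  case: (boolP [exists p, edge D p q]) => [/existsP[p epq]|/existsPn src].
    exists p; split; last by left.
    by apply: contraTneq epq => ->; exact: edge_irrefl.
  have /card_gt0P[p] : (0 < #|predC1 q|)%N by rewrite cardC1 card_ord; lia.
  by rewrite inE => pq; exists p; split=> //; right; rewrite -qW; exact: weight_source.
(* In multidegree [m], the localizations at [p] and [q] miss the monomial: the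
   values of [m] are [(W - 1) / W] and [0]. *)
pose m : 'X_{1..n} := (U_(q) *+ W.-1)%MM.
have W0 : (0 < W)%N by rewrite -qW weight_gt0.
have mdegm : mdeg m = W.-1 by rewrite mdegMn mdeg1 mul1n.
exists 2%N, (mdeg m)%:Z; split; last by rewrite mdegm; lia.
have wdotm v : wdot (link_val D v) m = link_val D v q * W.-1%:R.
  rewrite /wdot (bigD1 q) //= mulmnE mnm1E eqxx mul1n big1 ?addr0 // => i iq.
  by rewrite mulmnE mnm1E eq_sym (negPf iq) mulr0.
have not_in v : link_val D v q * W.-1%:R < 1 ->
    ~ in_loc (newton (@arc_mon n D) 1) 0 [set v] m.
  move=> lt1 /in_loc1[_]; rewrite (_ : [multinom _ | i < n] = m) ?wdotm ?leNgt ?lt1 //.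
  by apply/mnmP => i; rewrite mnmE subn0.
apply: (local_cohomology2_neq0 JP P_up pq).
- by move=> F F2; apply: in_loc_card2; rewrite ?F2.
- apply: not_in; case: pW => [epq|->]; last by rewrite mulr0.
  rewrite /link_val eq_sym (negPf pq) edgeN // epq /= qW.
  by rewrite ltr_pdivrMl ?ltr0n // mulr1 ltr_nat prednK.
- by apply: not_in; rewrite /link_val eqxx mul0r.
Qed.
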